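(* There is a size-preserving bijection between steady paths and valley-marked Dyck paths which sends the number of $W$ steps to the total mark, preserves the number of steps on the main diagonal, and sends the number of returns to the $x$-axis to the number of returns to the mark.
   Context: A steady path of size $n$ is a lattice path $P$ confined to the cone $\mathfrak{C}=\{(x,y)\in\mathbb{N}^2: y\le x\}$, using steps $U=(1,1)$, $D=(1,-1)$ and $W=(-1,1)$, without any factor (pair of consecutive steps) $WD$ or $DW$, starting at $(0,0)$ and ending at $(2n,0)$, such that: (S1) for any factor $UU$, the suffix of $P$ following this $UU$ factor lies weakly below the line parallel to $y=x$ passing through the $UU$ factor; (S2) for any factor $WU$, the suffix of $P$ following this $WU$ factor lies weakly below the line parallel to $y=x$ passing through the up step $U$ of the $WU$ factor. A Dyck path of semi-length $n$ is a lattice path with steps $U=(1,1)$, $D=(1,-1)$ from $(0,0)$ to $(2n,0)$ remaining weakly above the $x$-axis. A valley is a factor $DU$; it is located at the point $(i,k)$ between its two steps, and $k$ is its height. A valley-marked Dyck path of semi-length (size) $n$ is a Dyck path of semi-length $n$ in which each valley, located at $(i,k)$, receives a mark at one lattice point $(i,j)$ with $0\le j\le k$; $j$ is the height of the mark. The total mark is the sum of the heights of the marks. A return to the mark is a valley whose mark is on the valley itself ($j=k$). A return to the $x$-axis is a point of the path at height $0$ other than its starting and ending points (equivalently, a valley at height $0$). The main diagonal is the line $y=x$. *)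

(* Defs.v *)
From HB Require Import structures.
From mathcomp Require Import all_boot all_order all_algebra.

Set Implicit Arguments.
Unset Strict Implicit.
Unset Printing Implicit Defensive.

Import Order.TTheory GRing.Theory Num.Theory.
Local Open Scope ring_scope.

Inductive step := U | D | W.

Definition bool_of_step (a : step) : option bool :=
  match a with U => Some true | D => Some false | W => None end.
Definition step_of_bool (b : option bool) : step :=
  match b with Some true => U | Some false => D | None => W end.
Lemma bool_of_stepK : cancel bool_of_step step_of_bool.
Proof. by case. Qed.
HB.instance Definition _ := Countable.copy step (can_type bool_of_stepK).

Definition point : Type := (int * int)%type.

Definition step_vec (a : step) : point :=
  match a with U => (1, 1) | D => (1, -1) | W => (-1, 1) end.

(* The [size s].+1 lattice points visited by the path [s] from the origin. The
   [i]-th step of [s] goes from [(points s)`_i] to [(points s)`_i.+1]. *)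
Definition points (s : seq step) : seq point :=
  0 :: scanl (fun p a => p + step_vec a) 0 s.

(* The steps of [s] number [i] and [i.+1] are [a] and [b]. *)
Definition factor (a b : step) (s : seq step) (i : nat) : bool :=
  (onth s i == Some a) && (onth s i.+1 == Some b).

Definition in_cone (p : point) : bool :=
  [&& 0 <= p.1, 0 <= p.2 & p.2 <= p.1].

(* [p] is weakly below the line parallel to y = x passing through [q]. *)
Definition below_parallel (q p : point) : bool := p.2 <= p.1 + (q.2 - q.1).

Definition avoids (a b : step) (s : seq step) : bool :=
  all (fun i => ~~ factor a b s i) (iota 0 (size s)).

Definition cond_S1 (s : seq step) : bool :=
  all (fun i => factor U U s i ==>
         all (below_parallel (points s)`_i) (drop i.+2 (points s)))
      (iota 0 (size s)).

(* The up step of a factor [WU] at [i] starts at [(points s)`_i.+1]. *)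
Definition cond_S2 (s : seq step) : bool :=
  all (fun i => factor W U s i ==>
         all (below_parallel (points s)`_i.+1) (drop i.+2 (points s)))
      (iota 0 (size s)).

Definition is_steady (n : nat) (s : seq step) : bool :=
  [&& all in_cone (points s), last 0 (points s) == (n.*2%:Z, 0),
      avoids W D s, avoids D W s, cond_S1 s & cond_S2 s].

Definition steady_path (n : nat) : Type := {s : seq step | is_steady n s}.

Definition is_dyck (n : nat) (s : seq step) : bool :=
  [&& W \notin s, all (fun p : point => 0 <= p.2) (points s)
    & last 0 (points s) == (n.*2%:Z, 0)].

Definition valley_heights (s : seq step) : seq int :=
  [seq ((points s)`_i.+1).2 | i <- iota 0 (size s) & factor D U s i].

(* The second component lists the heights of the marks, from the leftmost valley
   to the rightmost one; [all2] forces exactly one mark per valley. *)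
Definition is_marked_dyck (n : nat) (sm : seq step * seq nat) : bool :=
  is_dyck n sm.1 &&
  all2 (fun (j : nat) (k : int) => j%:Z <= k) sm.2 (valley_heights sm.1).

Definition marked_dyck_path (n : nat) : Type :=
  {sm : seq step * seq nat | is_marked_dyck n sm}.

Definition on_diag (p : point) : bool := p.2 == p.1.

Definition diag_steps (s : seq step) : nat :=
  count (fun i => on_diag (points s)`_i && on_diag (points s)`_i.+1)
        (iota 0 (size s)).

Definition axis_returns (s : seq step) : nat :=
  count (fun i => ((points s)`_i).2 == 0) (iota 1 (size s).-1).

Definition total_mark (sm : seq step * seq nat) : nat := sumn sm.2.

Definition mark_returns (sm : seq step * seq nat) : nat :=
  count (fun jk : nat * int => jk.1%:Z == jk.2) (zip sm.2 (valley_heights sm.1)).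

(* Main.v *)
Require Import Defs.
From mathcomp Require Import all_boot all_order all_algebra.
From mathcomp Require Import ring zify.

Set Implicit Arguments.
Unset Strict Implicit.
Unset Printing Implicit Defensive.

Import Order.TTheory GRing.Theory Num.Theory.
Local Open Scope ring_scope.

(** The bijection is obtained by showing that the two finite families of size n
have the same joint distribution of the three statistics, and matching paths
with equal statistics.

Coding. Along a path put i = number of U steps made so far and a = (x - y)/2; then
U raises i, D raises a, W lowers a, and the height is y = i - a. As WD and DW are
excluded, a path is determined by the values e_0, ..., e_(n-1) of a at its n
up steps ([code_of], [path_of]), and staying in the cone means e_i <= i: the code
is an inversion sequence. Conditions S1 and S2 say together that every weak
descent v <= a of the code is followed only by values >= v ([steady_code],
[is_steady_path]); Dyck paths are the weakly increasing codes ([is_dyck_path]),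
with a valley of height i - e_i at every strict ascent. Steps on the diagonal are
the zeros of the code in both families.

Counting. Let q mark W steps (resp. total mark) and r mark returns. Completions of
a marked Dyck path depend only on the height h at the last up step, which gives
the recursion [dyck_gf]; the marks of a valley of height h contribute
w_h = 1 + q + ... + q^(h-1) + r q^h ([valley_weight]). Completions of a steady
code depend on h and on the room m above the current lower bound
([steady_gf]). The two recursions do not match state by state; what makes them
comparable is the number of zeros. Cut a steady code with at least c+1 zeros at
its (c+1)-st zero, preceded by k nonzero letters. Between two zeros a steady code
strictly increases, since a weak descent to a positive letter excludes later zeros,
and the total weight of the part before the cut is the complete homogeneous
symmetric polynomial h_k(q w_0, ..., q w_(c-1)) ([chain_gf], [chain_gf_run],
[steady_sum_chain]). Write Z_c(N) and E_c(N) for the weight of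
steady codes of size c+1+N with at least, resp. exactly, c+1 zeros. Then
 - Z_c(N+1) = E_c(N+1) + Z_(c+1)(N) ([atleast_gf_split]);
 - after the last zero, lowering all letters by one turns a completion without
   zeros into an arbitrary completion of a shorter code ([steady_gf_shift]);
   with the recursion of the symmetric polynomials, the previous identity and
   1 + q w_c = w_(c+1), this yields E_(c+1)(N+1) = E_c(N+1) + w_(c+1) Z_(c+1)(N)
   ([exactly_gfS]).
Hence Z_c(N+1) = Z_(c+1)(N) + sum over j <= c of w_j Z_j(N), the recursion of
[dyck_gf] for paths starting with at least c+1 up steps ([atleast_gf_dyck]).
Comparing coefficients of q and r for every c gives equal distributions
([perm_eq_stats]). *)

(** * Weights of completions *)

Section Weights.
Variables (R : comNzRingType) (q r : R).

(** Total weight of the marks of a valley of height k; see [valley_weightE] for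
the closed form. *)
Fixpoint valley_weight k : R := if k is k'.+1 then 1 + q * valley_weight k' else r.

(** Completions by N up steps when the last up step started at height h: the next
one starts at height h.+1, or after a valley at height j <= h. *)
Fixpoint dyck_gf N h : R :=
  if N is N'.+1 then
    dyck_gf N' h.+1 + \sum_(0 <= j < h.+1) valley_weight j * dyck_gf N' j
  else 1.

(** Completions of a steady code by N letters. With i letters read, last letter a
and lower bound b on the letters to come, h = i - a - 1 and m = i - b; a new letter v
is recorded by j = i - v, the height at which its up step starts. A value j <= h is
an ascent and keeps b; a value j > h is a weak descent, which creates j - h - 1
steps W and raises b to v. *)
Fixpoint steady_gf N h m : R :=
  if N is N'.+1 then
    \sum_(0 <= j < h.+1) r ^+ (j == 0%N) * steady_gf N' j m.+1 +
    \sum_(h.+1 <= j < m.+1) q ^+ (j - h.+1) * steady_gf N' j j.+1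
  else 1.

(** Runs of l increasing letters, after a letter at height h and before a zero. The W
steps that go back to zero after the run are charged to its letters, each one paying
for its increase: h.+1 - j for a letter at height j that follows one at height h. *)
Fixpoint run_gf l h : R :=
  if l is l'.+1 then
    \sum_(0 <= j < h.+1) q ^+ (h.+1 - j) * (r ^+ (j == 0%N) * run_gf l' j)
  else 1.

(** The complete homogeneous symmetric polynomial of degree k in the c variables
q * valley_weight i, i < c. *)
Fixpoint chain_gf c : nat -> R :=
  if c is c'.+1 then
    fix aux k := if k is k'.+1 then
      chain_gf c' k + q * valley_weight c' * aux k' else 1
  else fun k => (k == 0%N)%:R.

Arguments chain_gf : simpl never.

Lemma chain_gf0 c : chain_gf c 0 = 1. Proof. by case: c. Qed.

Lemma chain_gfS c k :
  chain_gf c.+1 k.+1 = chain_gf c k.+1 + q * valley_weight c * chain_gf c.+1 k.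
Proof. by []. Qed.

Lemma run_gfS l h : run_gf l.+1 h.+1 = q * run_gf l h.+1 + q * run_gf l.+1 h.
Proof.
rewrite [LHS]/= big_nat_recr //= subSnn expr1 expr0 mul1r addrC; congr (_ + _).
rewrite big_distrr /=; apply: eq_big_nat => j /andP[_ hj].
by rewrite [in LHS]subSn ?exprS ?mulrA // leqW.
Qed.

Lemma run_gf0 l : run_gf l 0 = (q * r) ^+ l.
Proof. by elim: l => //= l IH; rewrite big_nat1 subn0 !expr1 IH exprS mulrA. Qed.

Lemma chain_gf1 k : chain_gf 1 k = (q * r) ^+ k.
Proof.
elim: k => [|k IHk] //; rewrite chain_gfS IHk exprS.
by rewrite /chain_gf mulr0n add0r.
Qed.

(** Adding one more zero to a chain: both sides satisfy the recursion that defines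
[chain_gf c.+1]. The right-hand side does because of [run_gfS], whose two terms
give, by the induction hypotheses on c and K, the contributions q and
q * (q * valley_weight c) of the weight q * valley_weight c.+1. *)
Lemma chain_gf_run c K :
  chain_gf c.+1 K = \sum_(0 <= k < K.+1) chain_gf c k * run_gf (K - k) (c + k).
Proof.
elim: c K => [|c IHc] K.
  rewrite big_nat_recl // big1_seq => [|j _]; last by rewrite mul0r.
  by rewrite chain_gf1 mul1r addr0 subn0 run_gf0.
elim: K => [|K IHK]; first by rewrite big_nat1 !chain_gf0 mul1r.
(* The induction hypothesis on [c] at [K.+1], its last term being removed. *)
have first_part : \sum_(0 <= k < K.+1) chain_gf c k * run_gf (K.+1 - k) (c + k)
    = q * valley_weight c * chain_gf c.+1 K.
  apply: (addrI (chain_gf c K.+1)).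
  by rewrite -chain_gfS IHc [RHS]big_nat_recr //= subnn mulr1 addrC.
have split_part : \sum_(0 <= k < K.+1) chain_gf c.+1 k * run_gf (K.+1 - k) (c + k)
    = q * valley_weight c * chain_gf c.+2 K.
  rewrite big_nat_recl // chain_gf0.
  under eq_bigr => k _ do rewrite chain_gfS mulrDl.
  rewrite big_split /= addrA.
  have -> : 1 * run_gf (K.+1 - 0) (c + 0) +
     \sum_(0 <= i < K) chain_gf c i.+1 * run_gf (K.+1 - i.+1) (c + i.+1) =
     \sum_(0 <= k < K.+1) chain_gf c k * run_gf (K.+1 - k) (c + k).
    by rewrite [RHS]big_nat_recl // chain_gf0.
  rewrite first_part IHK big_nat_recr //= subnn mulr1 mulrDr addrC; congr (_ + _).
  rewrite big_distrr /=; apply: eq_bigr => k _.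
  by rewrite subSS addnS -!mulrA.
rewrite chain_gfS big_nat_recr //= subnn mulr1 addrC; congr (_ + _).
have -> : \sum_(0 <= i < K.+1) chain_gf c.+1 i * run_gf (K.+1 - i) (c.+1 + i) =
  q * chain_gf c.+2 K + q * (q * valley_weight c * chain_gf c.+2 K).
  rewrite -split_part IHK !big_distrr /= -big_split /=.
  apply: eq_big_nat => k /andP[_ hk].
  by rewrite subSn // addSn run_gfS -addSn; ring.
by rewrite /=; ring.
Qed.

(** The state reached just after a letter equal to the lower bound. *)
Definition min_gf N h := steady_gf N h h.+1.

(** Steady codes with c+1+N letters, by their number of zeros: k counts the nonzero
letters before the (c+1)-st zero, after which zeros are allowed or not. *)
Definition atleast_gf c N :=
  \sum_(0 <= k < N.+1) chain_gf c k * min_gf (N - k) (c + k).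
Definition exactly_gf c N :=
  \sum_(0 <= k < N.+1) chain_gf c k * steady_gf (N - k) (c + k) (c + k).

(** Here m = h.+1 means that the last letter is one below the lower bound, as
happens after the last zero of a code. Lowering all the letters to come by one makes
the last letter equal to the bound. *)
Lemma steady_gf_shift N h : steady_gf N h.+1 h.+1 = min_gf N h.
Proof.
rewrite /min_gf; case: N => //= N; rewrite [X in _ + X = _]big_geq // addr0.
rewrite big_nat1 subnn expr0.
by rewrite [LHS]big_nat_recr.
Qed.

Lemma exactly_gf0 N : exactly_gf 0 N.+1 = r * atleast_gf 0 N.
Proof.
have chain0 f M : \sum_(0 <= k < M.+1) chain_gf 0 k * f k = f 0%N.
  rewrite big_nat_recl // big1_seq => [|j _]; last by rewrite mul0r.
  by rewrite chain_gf0 mul1r addr0.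
rewrite /exactly_gf /atleast_gf !chain0 !subn0 addn0 /=.
by rewrite big_nat1 big_geq // addr0 expr1.
Qed.

(** The recursion of [chain_gf c.+1] splits the codes with exactly c+2 zeros; in
both parts [steady_gf_shift] removes the restriction on later zeros. *)
Lemma exactly_gfS c N :
  exactly_gf c.+1 N.+1 =
  atleast_gf c N.+1 + q * valley_weight c * atleast_gf c.+1 N.
Proof.
rewrite /exactly_gf big_nat_recl // chain_gf0.
under eq_bigr => k _ do rewrite chain_gfS mulrDl.
rewrite big_split /= addrA /atleast_gf big_distrr /=; congr (_ + _).
  rewrite [RHS]big_nat_recl // chain_gf0; congr (_ + _).
    by rewrite !addn0 !subn0 -steady_gf_shift.
  by apply: eq_bigr => k _; rewrite addSn steady_gf_shift.
apply: eq_bigr => k _.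
by rewrite subSS addSn addnS -addSn steady_gf_shift mulrA.
Qed.

(** The hypothesis is the partition of codes by whether they have one more zero,
proved on the codes themselves in [atleast_gf_split]. *)
Lemma atleast_gf_dyck :
    (forall c N, atleast_gf c N.+1 = exactly_gf c N.+1 + atleast_gf c.+1 N) ->
  forall N c, atleast_gf c N = dyck_gf N c.
Proof.
move=> split_min; elim=> [|N IHN] c.
  by rewrite /atleast_gf big_nat1 chain_gf0 mul1r.
have exactlyE d : exactly_gf d N.+1 =
    \sum_(0 <= j < d.+1) valley_weight j * atleast_gf j N.
  elim: d => [|d IHd]; first by rewrite exactly_gf0 big_nat1.
  rewrite exactly_gfS split_min IHd [RHS]big_nat_recr //=.
  by rewrite mulrDl mul1r addrA.
rewrite split_min exactlyE addrC /= IHN; congr (_ + _).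
by apply: eq_bigr => j _; rewrite IHN.
Qed.
End Weights.
Arguments chain_gf : simpl never.

(** * Codes and their weighted sums *)

Fixpoint is_inversion i (s : seq nat) : bool :=
  if s is v :: s' then (v <= i)%N && is_inversion i.+1 s' else true.

Fixpoint inversion_seqs i N : seq (seq nat) :=
  if N is N'.+1 then
    [seq v :: s | v <- iota 0 i.+1, s <- inversion_seqs i.+1 N']
  else [:: [::]].
Arguments inversion_seqs : simpl never.

Lemma inversion_seqsS i N :
  inversion_seqs i N.+1 =
  [seq v :: s | v <- iota 0 i.+1, s <- inversion_seqs i.+1 N].
Proof. by []. Qed.

Fixpoint steady_code a (s : seq nat) : bool :=
  if s is v :: s' then ((v <= a)%N ==> all (leq v) s') && steady_code v s'
  else true.

Fixpoint total_drop a (s : seq nat) : nat :=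
  if s is v :: s' then (a - v + total_drop v s')%N else 0.

(** A path meets the axis again between a D and a U, so at an ascent of the code, to the
largest letter allowed. *)
Fixpoint contacts a i (s : seq nat) : nat :=
  if s is v :: s' then ((a < v) && (v == i) + contacts v i.+1 s')%N else 0.

Fixpoint heights a i (s : seq nat) : seq nat :=
  if s is v :: s' then
    if (a < v)%N then (i - v)%N :: heights v i.+1 s' else heights v i.+1 s'
  else [::].

Lemma mem_inversion_seqs i N s :
  (s \in inversion_seqs i N) = (size s == N) && is_inversion i s.
Proof.
elim: N i s => [|N IHN] i s; first by rewrite inE; case: s.
rewrite inversion_seqsS; apply/allpairsPdep/idP.
  case=> v [s' [hv hs' ->]]; move: hv hs'.
  by rewrite mem_iota IHN /= eqSS ltnS => -> /andP[-> ->].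
case: s => [|v s] //; rewrite [X in X -> _]/= eqSS andbCA => /andP[hv hs]; exists v, s.
by rewrite IHN hs mem_iota.
Qed.

Lemma inversion_seqs_uniq i N : uniq (inversion_seqs i N).
Proof.
elim: N i => [|N IHN] i //; rewrite inversion_seqsS.
by apply: allpairs_uniq_dep => [||[? ?] [? ?] _ _ /= [-> ->]]; rewrite ?iota_uniq.
Qed.

(** The form of [steady_code] that can be checked letter by letter, with a running
lower bound b on all letters to come. *)
Definition bounded_code a b s := all (leq b) s && steady_code a s.

Lemma bounded_code_cons a b v s :
  bounded_code a b (v :: s) =
  (b <= v)%N && bounded_code v (if (v <= a)%N then v else b) s.
Proof.
rewrite /bounded_code /=; case: (leqP b v) => //= bv.
case: (leqP v a) => _ /=; last by [].
rewrite andbA; congr (_ && _); apply/andb_idl; apply: sub_all => x.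
exact: leq_trans.
Qed.

Section CodeSums.
Variables (R : comNzRingType) (q r : R).

(** The first letter is i - j, so that j is the height of the path there. *)
Lemma sum_inversion_seqsS i N (P : pred (seq nat)) (f : seq nat -> R) :
  \sum_(s <- inversion_seqs i N.+1 | P s) f s =
  \sum_(0 <= j < i.+1) \sum_(s <- inversion_seqs i.+1 N | P ((i - j)%N :: s))
     f ((i - j)%N :: s).
Proof.
rewrite big_mkcond inversion_seqsS big_allpairs_dep /=.
rewrite -[X in \sum_(_ <- X) _]/(index_iota 0 i.+1) big_nat_rev /=.
apply: eq_bigr => j _; rewrite add0n subSS.
by rewrite [RHS]big_mkcond.
Qed.

Lemma sum_guard (b : bool) (s : seq (seq nat)) (P : pred (seq nat)) f :
  \sum_(x <- s | b && P x) f x = (if b then \sum_(x <- s | P x) f x else 0) :> R.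
Proof. by case: b => //=; rewrite big_pred0_eq. Qed.

(** With a general weight t of the number of zeros, thresholds and exact numbers of
zeros are handled together, and reading a zero amounts to shifting t. *)
Definition steady_sum N a b i (t : nat -> R) :=
  \sum_(s <- inversion_seqs i N | bounded_code a b s)
     q ^+ total_drop a s * r ^+ contacts a i s * t (count_mem 0%N s).

Lemma steady_sum0 a b i t : steady_sum 0 a b i t = t 0%N.
Proof. by rewrite /steady_sum big_cons big_nil /= !expr0 !mul1r addr0. Qed.

Lemma steady_sumS N a b i t :
  steady_sum N.+1 a b i t =
  \sum_(0 <= j < i.+1 | (b <= i - j)%N)
     q ^+ (a - (i - j)) * r ^+ ((a < i - j)%N && (j == 0%N)) *
     steady_sum N (i - j) (if (i - j <= a)%N then i - j else b)%N i.+1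
       (fun z => t ((i - j == 0) + z)%N).
Proof.
rewrite /steady_sum sum_inversion_seqsS [RHS]big_mkcond.
apply: eq_big_nat => j /andP[_ ji].
under eq_bigl => s do rewrite bounded_code_cons.
rewrite sum_guard; case: ifP => // _.
have -> : (j == 0)%N = (i - j == i)%N by lia.
rewrite big_distrr; apply: eq_bigr => s _ /=.
by rewrite !exprD; ring.
Qed.

Lemma eq_steady_sum N a b i t t' :
  t =1 t' -> steady_sum N a b i t = steady_sum N a b i t'.
Proof. by move=> tt'; apply: eq_bigr => s _; rewrite tt'. Qed.

Lemma steady_sum_gf N a b i c :
    (a < i)%N -> (b <= a.+1)%N -> (b <= i)%N ->
  steady_sum N a b i (fun=> c) = c * steady_gf q r N (i - a.+1) (i - b).
Proof.
elim: N a b i => [|N IHN] a b i ai ba bi; first by rewrite steady_sum0 mulr1.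
rewrite steady_sumS /=.
have -> : (i - a.+1).+1 = (i - a)%N by lia.
have Hm : ((i - b).+1 <= i.+1)%N by lia.
transitivity (\sum_(0 <= j < (i - b).+1)
    q ^+ (a - (i - j)) * r ^+ ((a < i - j)%N && (j == 0%N)) *
    steady_sum N (i - j) (if (i - j <= a)%N then i - j else b)%N i.+1 (fun=> c)).
  rewrite [RHS](big_nat_widen _ _ _ _ _ Hm).
  by apply: congr_big_nat => // j /andP[_ ji]; lia.
(* A letter i - j is an ascent for j < i - a and a weak descent otherwise. *)
rewrite (big_cat_nat _ (n := (i - a)%N)) //=; last by lia.
rewrite mulrDr !big_distrr /=; congr (_ + _); apply: eq_big_nat => j /andP[j1 j2].
  have -> : (i - j <= a)%N = false by lia.
  have -> : (a < i - j)%N by lia.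
  have -> : (a - (i - j) = 0)%N by lia.
  rewrite IHN; [|lia..].
  have -> : (i.+1 - (i - j).+1 = j)%N by lia.
  have -> : (i.+1 - b = (i - b).+1)%N by lia.
  by rewrite expr0 /=; ring.
have -> : (i - j <= a)%N by lia.
have -> : (a < i - j)%N = false by lia.
rewrite IHN; [|lia..].
have -> : (i.+1 - (i - j).+1 = j)%N by lia.
have -> : (i.+1 - (i - j) = j.+1)%N by lia.
have -> : (a - (i - j) = j - (i - a))%N by lia.
by rewrite expr0 /=; ring.
Qed.

Lemma count_mem0_pos (s : seq nat) b :
  (0 < b)%N -> all (leq b) s -> count_mem 0%N s = 0%N.
Proof.
move=> b0 bs; apply/count_memPn; apply/negP => s0.
by have := allP bs _ s0; rewrite leqNgt b0.
Qed.

(** A positive lower bound excludes zeros. *)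
Lemma steady_sum_pos N a b i t :
  (0 < b)%N -> steady_sum N a b i t = steady_sum N a b i (fun=> t 0%N).
Proof.
move=> b0; apply: eq_bigr => s /andP[bs _].
by rewrite (count_mem0_pos b0 bs).
Qed.

(** Codes without zeros are those with lower bound 1. *)
Lemma steady_sum_zero N a i t :
    (a < i)%N -> (forall z, (0 < z)%N -> t z = 0) ->
  steady_sum N a 0 i t = t 0%N * steady_gf q r N (i - a.+1) (i - 1).
Proof.
move=> ai t0; rewrite -steady_sum_gf //; last by lia.
rewrite /steady_sum big_mkcond [RHS]big_mkcond; apply: eq_bigr => s _.
rewrite /bounded_code all_predT.
have [s1|] := boolP (all (leq 1) s); first by rewrite (count_mem0_pos _ s1).
rewrite -has_predC has_count => s1 /=; case: ifP => // _.
rewrite t0 ?mulr0 //; apply: leq_trans s1 _; apply: sub_count => x /=.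
by rewrite -leqNgt leqn0.
Qed.

(** When t 0 = 0 another zero must follow, so a weak descent to a positive letter, which
raises the lower bound above 0, contributes nothing. *)
Lemma steady_sum_next N a i t :
    (a < i)%N -> t 0%N = 0 ->
  steady_sum N.+1 a 0 i t =
  q ^+ a * steady_sum N 0 0 i.+1 (fun z => t z.+1) +
  \sum_(0 <= j < i - a) r ^+ (j == 0%N) * steady_sum N (i - j) 0 i.+1 t.
Proof.
move=> ai t0; rewrite steady_sumS big_nat_recr //= subnn subn0 ltn0 /=.
rewrite mulr1 addrC; congr (_ + _).
rewrite (big_cat_nat _ (n := (i - a)%N)) //=; last by lia.
rewrite [X in _ + X]big1_seq ?addr0 => [|j].
  apply: eq_big_nat => j /andP[_ j2].
  have -> : (i - j <= a)%N = false by lia.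
  have -> : (a < i - j)%N by lia.
  have -> : (i - j == 0)%N = false by lia.
  have -> : (a - (i - j) = 0)%N by lia.
  by rewrite mul1r.
rewrite mem_index_iota => /andP[_ /andP[j1 j2]].
have -> : (i - j <= a)%N by lia.
have -> : (i - j == 0)%N = false by lia.
rewrite steady_sum_pos /=; last by lia.
by rewrite t0 /steady_sum big1 ?mulr0 // => s _; rewrite mulr0.
Qed.

(** Before the next zero the code strictly increases; l is the length of this run. *)
Lemma steady_sum_run N a i t :
    (a < i)%N -> t 0%N = 0 ->
  steady_sum N.+1 a 0 i t =
  \sum_(0 <= l < N.+1) q ^+ a * run_gf q r l (i - a.+1) *
     steady_sum (N - l) 0 0 (i + l).+1 (fun z => t z.+1).
Proof.
move=> + t0; elim: N a i => [|N IHN] a i ai; rewrite steady_sum_next //.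
  rewrite big_nat1 addn0 mulr1 big1_seq ?addr0 // => j _.
  by rewrite steady_sum0 t0 mulr0.
rewrite big_nat_recl // mulr1 addn0 subn0; congr (_ + _).
have -> : (i - a = (i - a.+1).+1)%N by lia.
transitivity (\sum_(0 <= j < (i - a.+1).+1) \sum_(0 <= l < N.+1)
   q ^+ a * (q ^+ ((i - a.+1).+1 - j) * (r ^+ (j == 0%N) * run_gf q r l j)) *
   steady_sum (N - l) 0 0 (i + l.+1).+1 (fun z => t z.+1)).
  apply: eq_big_nat => j /andP[_ j2]; rewrite IHN; last by lia.
  rewrite big_distrr; apply: eq_bigr => l _ /=.
  have -> : (i.+1 - (i - j).+1 = j)%N by lia.
  have -> : (i - j = a + ((i - a.+1).+1 - j))%N by lia.
  by rewrite exprD addSnnS; ring.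
rewrite exchange_big /=; apply: eq_bigr => l _.
by rewrite subSS -big_distrl -big_distrr.
Qed.

Lemma big_triangle n (f : nat -> nat -> R) :
  \sum_(0 <= K < n) \sum_(0 <= k < K.+1) f k (K - k)%N =
  \sum_(0 <= k < n) \sum_(0 <= l < n - k) f k l.
Proof.
elim: n => [|n IHn]; first by rewrite !big_geq.
rewrite big_nat_recr //= IHn [RHS]big_nat_recr //= subSnn big_nat1.
rewrite [X in _ + X]big_nat_recr //= subnn addrA; congr (_ + _).
rewrite -big_split /=; apply: eq_big_nat => k /andP[_ kn].
by rewrite subSn 1?ltnW // big_nat_recr.
Qed.

(** Cutting at the (c+1)-st zero, if t forces that many zeros; the sums start after the
first letter, which is always 0. *)
Lemma steady_sum_chain c N t :
    (forall z, (z < c)%N -> t z = 0) ->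
  steady_sum (c + N) 0 0 1 t =
  \sum_(0 <= k < N.+1) chain_gf q r c k *
     steady_sum (N - k) 0 0 (c + k).+1 (fun z => t (c + z)%N).
Proof.
elim: c N => [|c IHc] N tc.
  rewrite big_nat_recl // big1_seq ?addr0 => [|k _].
    by rewrite chain_gf0 mul1r subn0.
  by rewrite mul0r.
rewrite addSnnS IHc => [|z zc]; last by apply/tc/ltnW.
rewrite big_nat_recr //= subnn steady_sum0 addn0 tc // mulr0 addr0.
transitivity (\sum_(0 <= k < N.+1) \sum_(0 <= l < N.+1 - k)
   chain_gf q r c k * run_gf q r l (c + k) *
   steady_sum (N - (k + l)) 0 0 (c.+1 + (k + l)).+1 (fun z => t (c.+1 + z)%N)).
  apply: eq_big_nat => k /andP[_ kN]; rewrite subSn //.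
  rewrite steady_sum_run ?addn0 ?tc // big_distrr; apply: eq_bigr => l _ /=.
  rewrite subn1 /= expr0 mul1r mulrA subnDA; congr (_ * _).
  rewrite addSn addnA; apply: eq_steady_sum => z.
  by rewrite addSnnS.
rewrite -(big_triangle N.+1 (fun k l => chain_gf q r c k * run_gf q r l (c + k) *
   steady_sum (N - (k + l)) 0 0 (c.+1 + (k + l)).+1 (fun z => t (c.+1 + z)%N))).
apply: eq_bigr => K _; rewrite chain_gf_run big_distrl.
by apply: eq_big_nat => k /andP[_ kK]; rewrite subnKC.
Qed.

Definition atleast c z : R := (c <= z)%N%:R.

Lemma steady_sum_atleast c N :
  steady_sum (c + N) 0 0 1 (atleast c) = atleast_gf q r c N.
Proof.
rewrite steady_sum_chain => [|z zc]; last by rewrite /atleast leqNgt zc.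
apply: eq_bigr => k _; congr (_ * _).
under eq_steady_sum => z do rewrite /atleast leq_addr.
by rewrite steady_sum_gf // subn1 subn0 mul1r.
Qed.

Lemma atleast_gf_split c N :
  atleast_gf q r c N.+1 = exactly_gf q r c N.+1 + atleast_gf q r c.+1 N.
Proof.
pose exactly z : R := (z == c)%:R.
have <- : steady_sum (c + N.+1) 0 0 1 exactly = exactly_gf q r c N.+1.
  rewrite steady_sum_chain => [|z zc]; last by rewrite /exactly ltn_eqF.
  apply: eq_bigr => k _; congr (_ * _).
  rewrite steady_sum_zero // => [|z z0].
    by rewrite /exactly addn0 eqxx mul1r !subn1.
  by rewrite /exactly -[X in _ == X]addn0 eqn_add2l eqn0Ngt z0.
rewrite -!steady_sum_atleast -addSnnS -big_split; apply: eq_bigr => s _ /=.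
rewrite -mulrDr; congr (_ * _).
by rewrite /atleast /exactly leq_eqVlt eq_sym; case: ltngtP; rewrite ?addr0 ?add0r.
Qed.

Definition dyck_sum N a i (t : nat -> R) :=
  \sum_(s <- inversion_seqs i N | path leq a s)
     (\prod_(h <- heights a i s) valley_weight q r h) * t (count_mem 0%N s).

Lemma dyck_sum0 a i t : dyck_sum 0 a i t = t 0%N.
Proof. by rewrite /dyck_sum big_cons big_nil /= big_nil mul1r addr0. Qed.

Lemma dyck_sumS N a i t :
  dyck_sum N.+1 a i t =
  \sum_(0 <= j < i.+1 | (a <= i - j)%N)
     (if (a < i - j)%N then valley_weight q r j else 1) *
     dyck_sum N (i - j) i.+1 (fun z => t ((i - j == 0) + z)%N).
Proof.
rewrite /dyck_sum sum_inversion_seqsS [RHS]big_mkcond.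
apply: eq_big_nat => j /andP[_ ji] /=.
rewrite sum_guard; case: ifP => // _.
rewrite big_distrr; apply: eq_bigr => s _ /=.
by case: ifP => _; rewrite ?big_cons ?subKn ?mul1r ?mulrA.
Qed.

Lemma eq_dyck_sum N a i t t' :
  t =1 t' -> dyck_sum N a i t = dyck_sum N a i t'.
Proof. by move=> tt'; apply: eq_bigr => s _; rewrite tt'. Qed.

Lemma dyck_sum_gf N a i c :
  (a < i)%N -> dyck_sum N a i (fun=> c) = c * dyck_gf q r N (i - a.+1).
Proof.
elim: N a i => [|N IHN] a i ai; first by rewrite dyck_sum0 mulr1.
rewrite dyck_sumS /=.
have -> : (i - a.+1).+1 = (i - a)%N by lia.
have Hm : ((i - a).+1 <= i.+1)%N by lia.
transitivity (\sum_(0 <= j < (i - a).+1)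
     (if (a < i - j)%N then valley_weight q r j else 1) *
     dyck_sum N (i - j) i.+1 (fun=> c)).
  rewrite [RHS](big_nat_widen _ _ _ _ _ Hm).
  by apply: congr_big_nat => // j /andP[_ ji]; lia.
rewrite big_nat_recr //= addrC mulrDr; congr (_ + _).
  have -> : (i - (i - a) = a)%N by lia.
  by rewrite ltnn IHN ?mul1r ?subSS // ltnW.
rewrite big_distrr; apply: eq_big_nat => j /andP[_ j2] /=.
have -> : (a < i - j)%N by lia.
rewrite IHN; last by lia.
have -> : (i.+1 - (i - j).+1 = j)%N by lia.
by ring.
Qed.

Lemma dyck_sum_pos N a i t : (0 < a)%N -> dyck_sum N a i t = dyck_sum N a i (fun=> t 0%N).
Proof.
move=> a0; apply: eq_bigr => s; rewrite (path_sortedE leq_trans) => /andP[bs _].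
by rewrite (count_mem0_pos a0 bs).
Qed.

(** The zeros of a weakly increasing code come first. *)
Lemma dyck_sum_zeros c N i t :
    (forall z, (z < c)%N -> t z = 0) ->
  dyck_sum (c + N) 0 i t = dyck_sum N 0 (c + i) (fun z => t (c + z)%N).
Proof.
elim: c i t => [|c IHc] i t tc //.
rewrite dyck_sumS big_nat_recr //= big1_seq ?add0r => [|j].
  rewrite subnn mul1r IHc => [|z zc]; last exact: tc.
  by rewrite addSnnS; apply: eq_dyck_sum => z.
rewrite mem_index_iota => /andP[_ /andP[_ ji]].
rewrite dyck_sum_pos ?subn_gt0 //= tc; last by lia.
by rewrite /dyck_sum big1 ?mulr0 // => s _; rewrite mulr0.
Qed.

Lemma mem_inversion_seqs_size i N s : s \in inversion_seqs i N -> size s = N.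
Proof. by rewrite mem_inversion_seqs => /andP[/eqP]. Qed.

Theorem steady_sum_dyck_sum c N :
  steady_sum N 0 0 1 (atleast c) = dyck_sum N 0 1 (atleast c).
Proof.
have [cN|Nc] := leqP c N; last first.
  rewrite /steady_sum /dyck_sum !big1_seq // => s /andP[_ /mem_inversion_seqs_size sN];
  by rewrite /atleast leqNgt (leq_ltn_trans (count_size _ _)) ?sN ?mulr0.
rewrite -(subnKC cN) steady_sum_atleast (atleast_gf_dyck atleast_gf_split).
rewrite dyck_sum_zeros => [|z zc]; last by rewrite /atleast leqNgt zc.
under eq_dyck_sum => z do rewrite /atleast leq_addr.
by rewrite dyck_sum_gf addn1 ?subn1 ?mul1r.
Qed.
End CodeSums.

(** * Coding paths without WD and DW *)

Definition jump a v : seq step := nseq (v - a) D ++ nseq (a - v) W.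

Fixpoint path_of n a (es : seq nat) : seq step :=
  if es is v :: es' then jump a v ++ U :: path_of n v es' else jump a n.

Fixpoint code_of a (s : seq step) : seq nat :=
  match s with
  | U :: s' => a :: code_of a s'
  | D :: s' => code_of a.+1 s'
  | W :: s' => code_of a.-1 s'
  | [::] => [::]
  end.

(** Holds as long as the truncated predecessor in [code_of] and [advance] follows the
actual path. *)
Fixpoint legal a (s : seq step) : bool :=
  match s with
  | U :: s' => legal a s'
  | D :: s' => legal a.+1 s'
  | W :: s' => (0 < a)%N && legal a.-1 s'
  | [::] => true
  end.

(** The effect of a step on the pair (i, a) of the number of up steps made and of
(x - y)/2. *)
Definition advance (c : nat * nat) (x : step) : nat * nat :=
  match x with U => (c.1.+1, c.2) | D => (c.1, c.2.+1) | W => (c.1, c.2.-1) end.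

Definition point_at (c : nat * nat) : point := ((c.1 + c.2)%N%:Z, c.1%:Z - c.2%:Z).

Definition walk (p : point) (s : seq step) : seq point :=
  scanl (fun p a => p + step_vec a) p s.

Lemma jumpnn a : jump a a = [::]. Proof. by rewrite /jump subnn. Qed.

Lemma jump_up a k : jump a (a + k) = nseq k D.
Proof.
have -> : jump a (a + k) = nseq k D ++ nseq 0 W by congr (nseq _ D ++ nseq _ W); lia.
exact: cats0.
Qed.

Lemma jump_down k v : jump (v + k) v = nseq k W.
Proof.
have -> // : jump (v + k) v = nseq 0 D ++ nseq k W.
by congr (nseq _ D ++ nseq _ W); lia.
Qed.

Variant jump_spec : nat -> nat -> seq step -> Prop :=
  | JumpUp a k : jump_spec a (a + k) (nseq k D)
  | JumpDown v k : jump_spec (v + k.+1) v (nseq k.+1 W).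

Lemma jumpP a v : jump_spec a v (jump a v).
Proof.
have [av|va] := leqP a v.
  by rewrite -(subnKC av) jump_up; apply: JumpUp.
have -> : a = (v + (a - v).-1.+1)%N by lia.
by rewrite jump_down; apply: JumpDown.
Qed.

Lemma jumpD a v : (a < v)%N -> jump a v = D :: jump a.+1 v.
Proof.
by move=> av; rewrite -(subnKC av) jump_up addSnnS jump_up.
Qed.

Lemma jumpW a v : (v <= a)%N -> jump a.+1 v = W :: jump a v.
Proof. by move=> va; rewrite -(subnKC va) -addnS !jump_down. Qed.

Lemma code_of_jump a v s : code_of a (jump a v ++ s) = code_of v s.
Proof.
case: jumpP => {}a k.
  by elim: k a => [|k IHk] a /=; rewrite ?addn0 // IHk addSnnS.
by rewrite addnS; elim: k => [|k IHk] /=; rewrite ?addn0 // addnS.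
Qed.

Lemma code_of_path n a es : code_of a (path_of n a es) = es.
Proof.
elim: es a => [|v es IHes] a /=; first by rewrite -[jump a n]cats0 code_of_jump.
by rewrite code_of_jump /= IHes.
Qed.

Lemma legal_jump a v s : legal a (jump a v ++ s) = legal v s.
Proof.
case: jumpP => {}a k.
  by elim: k a => [|k IHk] a /=; rewrite ?addn0 // IHk addSnnS.
by rewrite addnS; elim: k => [|k IHk] /=; rewrite ?addn0 // addnS.
Qed.

Lemma legal_path n a es : legal a (path_of n a es).
Proof.
elim: es a => [|v es IHes] a /=; first by rewrite -[jump a n]cats0 legal_jump.
by rewrite legal_jump /= IHes.
Qed.

Lemma point_at_move c x s : legal c.2 (x :: s) ->
  point_at c + step_vec x = point_at (advance c x) /\ legal (advance c x).2 s.
Proof.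
case: c => i a; case: x => /= lg; split=> //; try by congr pair => /=; lia.
by case/andP: lg.
Qed.

Lemma walk_point_at c s :
  legal c.2 s -> walk (point_at c) s = map point_at (scanl advance c s).
Proof.
elim: s c => [|x s IHs] c // /point_at_move[xP lg].
by rewrite /walk /= xP; congr (_ :: _); apply: IHs.
Qed.

Lemma in_cone_point_at c : in_cone (point_at c) = (c.2 <= c.1)%N.
Proof. by rewrite /in_cone /point_at /=; lia. Qed.

Lemma on_diag_point_at c : on_diag (point_at c) = (c.2 == 0)%N.
Proof. by rewrite /on_diag /point_at /=; lia. Qed.

Lemma below_parallel_point_at c d :
  below_parallel (point_at c) (point_at d) = (c.2 <= d.2)%N.
Proof. by rewrite /below_parallel /point_at /=; lia. Qed.

Lemma iota0S n : iota 0 n.+1 = 0%N :: map S (iota 0 n).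
Proof. by rewrite /= (iotaDl 1 0). Qed.

Lemma avoids_cons a b x s :
  avoids a b (x :: s) = ~~ ((x == a) && (ohead s == Some b)) && avoids a b s.
Proof. by rewrite /avoids [size _]/= iota0S /= all_map; case: s. Qed.

(** Without WD and DW, the steps between two up steps are all D or all W, as in
[jump]. *)
Lemma path_of_code_of n i a s :
    legal a s -> avoids W D s -> avoids D W s ->
  (foldl advance (i, a) s).2 = n -> path_of n a (code_of a s) = s.
Proof.
elim: s i a => [|x s IHs] i a; first by move=> _ _ _ /= ->; rewrite jumpnn.
rewrite !avoids_cons => H /andP[hWD WD] /andP[hDW DW] /= Hn.
have {IHs} := fun j b Hb => IHs j b Hb WD DW; case: x H hWD hDW Hn => /= H hWD hDW Hn IH.
- by rewrite jumpnn (IH i.+1).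
- have := IH _ _ H Hn; case E : (code_of a.+1 s) => [|v es] /=.
    case: (ltnP a n) => [/jumpD -> -> //|na].
    by rewrite jumpW // => sE; move: hDW; rewrite -sE.
  case: (ltnP a v) => [/jumpD -> /= -> //|na].
  by rewrite jumpW // => sE; move: hDW; rewrite -sE.
- case/andP: H; case: a Hn => // a Hn _ {}H.
  have := IH _ _ H Hn; rewrite /=; case E : (code_of a s) => [|v es] /=.
    case: (leqP n a) => [/jumpW -> -> //|na].
    by rewrite jumpD // => sE; move: hWD; rewrite -sE.
  case: (leqP v a) => [/jumpW -> /= -> //|na].
  by rewrite jumpD // => sE; move: hWD; rewrite -sE.
Qed.

(** * Steady and Dyck paths read on their codes *)

Lemma legal_in_cone c s : all in_cone (walk (point_at c) s) -> legal c.2 s.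
Proof.
elim: s c => [|x s IHs] [i a] // /andP[cone H].
have {}IHs d : point_at (i, a) + step_vec x = point_at d -> legal d.2 s.
  move=> pE; by apply: IHs; move: H; rewrite -/(walk _ s) pE.
case: x cone H IHs => /= cone H IHs.
- by apply: (IHs (i.+1, a)); congr pair => /=; lia.
- by apply: (IHs (i, a.+1)); congr pair => /=; lia.
case: a cone H IHs => [|a] cone H IHs.
  by move: cone; rewrite /in_cone /=; lia.
by apply: (IHs (i, a)); congr pair => /=; lia.
Qed.

(** A property that holds all along a jump as soon as it holds at its end is only to be
checked there. *)
Lemma all_scanl_jump (P : pred (nat * nat)) i a v s :
    (forall j, (minn a v <= j <= maxn a v)%N -> P (i, v) -> P (i, j)) ->
    P (i, a) ->
  all P (scanl advance (i, a) (jump a v ++ s)) =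
  P (i, v) && all P (scanl advance (i, v) s).
Proof.
case: jumpP => {}a k.
  elim: k a => [|k IHk] a Pj Pa /=; first by rewrite addn0 Pa.
  have [Pa1|nPa1] := boolP (P (i, a.+1)).
    by rewrite IHk ?addSnnS // => j jP; apply: Pj; lia.
  by apply/esym/negP => /andP[Pv _]; case/negP: nPa1; apply: Pj => //; lia.
move: k.+1 => {}k; elim: k => [|k IHk] Pj Pa /=.
  by rewrite addn0 in Pa *; rewrite Pa.
rewrite addnS /=.
have [Pa1|nPa1] := boolP (P (i, (a + k)%N)).
  by rewrite IHk // => j jP; apply: Pj; lia.
by apply/esym/negP => /andP[Pv _]; case/negP: nPa1; apply: Pj => //; lia.
Qed.

Definition in_cone_nat (c : nat * nat) := (c.2 <= c.1)%N.

Lemma all_in_cone_path n i a es : (a <= i)%N -> (n = i + size es)%N ->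
  all in_cone_nat (scanl advance (i, a) (path_of n a es)) = is_inversion i es.
Proof.
elim: es i a n => [|v es IHes] i a n ai /= nE.
  rewrite -[jump a n]cats0 all_scanl_jump /in_cone_nat /=; try move=> *; lia.
rewrite all_scanl_jump; [|by rewrite /in_cone_nat /= => *; lia..].
rewrite /= {1 2}/in_cone_nat /=; case: leqP => //= vi; rewrite leqW //= IHes //=; lia.
Qed.

Lemma all_above_path b n i a es : (b <= a)%N -> (b <= n)%N ->
  all (fun c => b <= c.2)%N (scanl advance (i, a) (path_of n a es)) = all (leq b) es.
Proof.
move=> + bn; elim: es i a => [|v es IHes] i a ba /=.
  by rewrite -[jump a n]cats0 all_scanl_jump /=; try move=> *; lia.
rewrite all_scanl_jump /=; [|by move=> *; lia..].
by case: leqP => //= bv; rewrite IHes.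
Qed.

Lemma last_path n i a es : foldl advance (i, a) (path_of n a es) = (i + size es, n)%N.
Proof.
have jumpE j b v : foldl advance (j, b) (jump b v) = (j, v).
  case: jumpP => {}b k.
    by elim: k b => [|k IHk] b /=; rewrite ?addn0 // IHk addSnnS.
  by rewrite addnS; elim: k => [|k IHk] /=; rewrite ?addn0 // -[in RHS]IHk /= addnS.
elim: es i a => [|v es IHes] i a /=; first by rewrite jumpE addn0.
by rewrite foldl_cat jumpE /= IHes addSnnS.
Qed.

Lemma avoids_nseq x y z k s :
    x != y -> (z != x) || (ohead s != Some y) ->
  avoids x y (nseq k z ++ s) = avoids x y s.
Proof.
move=> xy zs; elim: k => [|k IHk] //=; rewrite avoids_cons IHk.
case: k {IHk} => [|k] /=; first by rewrite negb_and zs.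
by case: eqP => //= ->; case: eqP => // -[yx]; rewrite yx eqxx in xy.
Qed.

Lemma avoids_path n a es x y :
  x != y -> x != U -> y != U -> avoids x y (path_of n a es).
Proof.
move=> xy xU yU.
have jumpE b v s : all (pred1 U) (take 1 s) -> 
    avoids x y (jump b v ++ s) = avoids x y s.
  case: jumpP => {}b k hs; rewrite avoids_nseq //;
    by apply/orP; right; case: s hs => [|? ?] //= /andP[/eqP-> _];
       apply: contra yU => /eqP[->].
elim: es a => [|v es IHes] a /=; first by rewrite -[jump a n]cats0 jumpE.
rewrite jumpE; last by rewrite /= take0.
by rewrite avoids_cons [U == x]eq_sym (negPf xU) IHes.
Qed.

(** S1 and S2 merged: in a factor UU both up steps lie on the same line, so the line
of either condition is the one through the second step. *)
Fixpoint minimal_after c (s : seq step) : bool :=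
  if s is x :: s' then
    ((x != D) && (ohead s' == Some U) ==>
       all (fun d => (advance c x).2 <= d.2)%N (scanl advance (advance c x) s'))
    && minimal_after (advance c x) s'
  else true.

Lemma cond_S12E s : legal 0 s -> cond_S1 s && cond_S2 s = minimal_after (0%N, 0%N) s.
Proof.
pose S1 p s := all (fun i => factor U U s i ==>
  all (below_parallel (nth 0 (p :: walk p s) i)) (drop i.+2 (p :: walk p s)))
  (iota 0 (size s)).
pose S2 p s := all (fun i => factor W U s i ==>
  all (below_parallel (nth 0 (p :: walk p s) i.+1)) (drop i.+2 (p :: walk p s)))
  (iota 0 (size s)).
have S1_cons p x s' : S1 p (x :: s') = ((x == U) && (ohead s' == Some U) ==>
    all (below_parallel p) (walk (p + step_vec x) s')) && S1 (p + step_vec x) s'.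
  by rewrite /S1 [size _]/= iota0S /= all_map drop0; case: s'.
have S2_cons p x s' : S2 p (x :: s') = ((x == W) && (ohead s' == Some U) ==>
    all (below_parallel (p + step_vec x)) (walk (p + step_vec x) s'))
    && S2 (p + step_vec x) s'.
  by rewrite /S2 [size _]/= iota0S /= all_map drop0; case: s'.
rewrite -[cond_S1 s]/(S1 0 s) -[cond_S2 s]/(S2 0 s).
rewrite -[S1 0 s]/(S1 (point_at (0, 0)%N) s) -[S2 0 s]/(S2 (point_at (0, 0)%N) s).
rewrite -[legal 0 s]/(legal (0, 0).2 s)%N.
elim: s (0, 0)%N => [|x s' IHs] [i a] // H.
have [xP H'] := point_at_move H.
have below c : c.2 = (advance (i, a) x).2 -> 
    all (below_parallel (point_at c)) (walk (point_at (advance (i, a) x)) s') =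
    all (fun d => (advance (i, a) x).2 <= d.2)%N (scanl advance (advance (i, a) x) s').
  move=> cE; rewrite walk_point_at // all_map; apply: eq_all => d /=.
  by rewrite below_parallel_point_at cE.
rewrite S1_cons S2_cons xP /= -IHs //.
case: x {H xP} below H' => below H' /=; rewrite ?below //=.
  by rewrite andbA.
by rewrite andbCA.
Qed.

Lemma minimal_after_up i a k s :
  minimal_after (i, a) (nseq k D ++ s) = minimal_after (i, a + k)%N s.
Proof. by elim: k a => [|k IHk] a /=; rewrite ?addn0 // IHk addSnnS. Qed.

Lemma minimal_after_down i v k s :
  minimal_after (i, v + k.+1)%N (nseq k.+1 W ++ U :: s) =
  all (fun d => v <= d.2)%N (scanl advance (i, v) (U :: s)) &&
  minimal_after (i, v) (U :: s).
Proof.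
elim: k => [|k IHk]; first by rewrite addn1.
by rewrite addnS; apply: IHk.
Qed.

(** The leading U stands for the previous letter of the code: it is the first step of
the factor UU met when the next letter is equal to a. *)
Lemma minimal_after_path n i a es : all (leq^~ n) (a :: es) ->
  minimal_after (i, a) (U :: path_of n a es) = steady_code a es.
Proof.
elim: es i a => [|v es IHes] i a.
  rewrite /= andbT => an; rewrite -(subnKC an) jump_up -[nseq _ _]cats0.
  by rewrite minimal_after_up; case: (n - a)%N.
move=> /andP[an vesn]; have {}IHes j := IHes j v vesn; case/andP: vesn => vn _.
have minimalU c s : minimal_after c (U :: s) = ((ohead s == Some U) ==>
  all (fun d => c.2 <= d.2)%N (scanl advance (c.1.+1, c.2) s)) &&
  minimal_after (c.1.+1, c.2) s.
  by [].
rewrite [path_of _ _ _]/= minimalU /=; case: jumpP vn IHes {an} => {}a k vn IHes.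
  case: k => [|k] in vn IHes *.
    rewrite addn0 in vn IHes *; rewrite [nseq 0 _ ++ _]/= IHes leqnn /= leqnn /=.
    by rewrite all_above_path.
  by rewrite minimal_after_up IHes /= leqNgt -addSnnS ltn_addr.
rewrite minimal_after_down IHes leq_addr /= leqnn /=.
by rewrite all_above_path.
Qed.

Lemma pointsE s :
  legal 0 s -> points s = map point_at ((0, 0)%N :: scanl advance (0, 0)%N s).
Proof. by move=> lg; rewrite /= -walk_point_at. Qed.

Lemma last_points s :
  legal 0 s -> last 0 (points s) = point_at (foldl advance (0, 0)%N s).
Proof.
move=> /pointsE ->; rewrite /= last_map; congr point_at.
by elim: s (0, 0)%N => //= x s IHs c; rewrite IHs.
Qed.

Lemma mem_inversion_lt i es v : is_inversion i es -> v \in es -> (v < i + size es)%N.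
Proof.
elim: es i => //= w es IHes i /andP[wi /IHes esP].
by rewrite inE => /predU1P[-> | /esP]; lia.
Qed.

Lemma is_steady_path n es :
  is_steady n (path_of n 0 es) =
  [&& size es == n, is_inversion 0 es & steady_code 0 es].
Proof.
have lg := legal_path n 0 es.
rewrite /is_steady last_points // last_path pointsE // all_map.
rewrite !avoids_path // cond_S12E //.
rewrite (eq_all (a2 := in_cone_nat)) => [|c]; last exact: in_cone_point_at.
rewrite /= add0n.
have -> : (point_at (size es, n) == (n.*2%:Z, 0)) = (size es == n).
  by rewrite /point_at xpair_eqE /=; lia.
have [sn|_] := eqVneq (size es) n; last by rewrite andbF.
rewrite all_in_cone_path ?sn //=; case invP: (is_inversion 0 es) => //=.
case: es sn invP lg => [|v es] /= sn; first by rewrite -sn.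
case/andP; rewrite leqn0 => /eqP -> inves _; rewrite jumpnn.
rewrite minimal_after_path ?all_predT //=.
by apply/allP => w /(mem_inversion_lt inves); rewrite -sn; lia.
Qed.

Lemma is_steady_code n s : is_steady n s -> path_of n 0 (code_of 0 s) = s.
Proof.
case/and5P => cone lst WD DW _.
have lg : legal 0 s by apply: (@legal_in_cone (0, 0)%N); case/andP: cone.
apply: (path_of_code_of (i := 0)) => //; move: lst; rewrite last_points //.
by rewrite /point_at xpair_eqE /=; lia.
Qed.

Lemma path_leq_notin_W n a es : all (leq^~ n) (a :: es) ->
  (W \notin path_of n a es) = path leq a es.
Proof.
elim: es a => [|v es IHes] a.
  by rewrite /= andbT => an; rewrite -(subnKC an) jump_up mem_nseq andbF.
move=> /andP[an vesn] /=; rewrite mem_cat in_cons negb_or /= IHes //.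
congr (_ && _); case: jumpP => {an}a k; first by rewrite mem_nseq andbF leq_addr.
by rewrite mem_nseq eqxx /= [RHS]leqNgt -addSnnS leq_addr.
Qed.

Lemma is_dyck_path n es :
  is_dyck n (path_of n 0 es) = [&& size es == n, is_inversion 0 es & path leq 0 es].
Proof.
have lg := legal_path n 0 es.
rewrite /is_dyck last_points // last_path pointsE // all_map.
rewrite (eq_all (a2 := in_cone_nat)) => [|c]; last by rewrite /in_cone_nat /=; lia.
rewrite /= add0n.
have -> : (point_at (size es, n) == (n.*2%:Z, 0)) = (size es == n).
  by rewrite /point_at xpair_eqE /=; lia.
have [sn|_] := eqVneq (size es) n; last by rewrite !andbF.
rewrite all_in_cone_path ?sn //= andbT andbC; case invP: (is_inversion 0 es) => //=.
by rewrite path_leq_notin_W //=; apply/allP => w /(mem_inversion_lt invP); lia.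
Qed.

Lemma is_dyck_code n s : is_dyck n s -> path_of n 0 (code_of 0 s) = s.
Proof.
case/and3P => noW _ lst.
have lg : legal 0 s.
  by elim: s 0%N noW {lst} => //= x s IHs a; rewrite inE negb_or; case: x => //= /IHs.
have avoidsW x y : W \in [:: x; y] -> avoids x y s.
  rewrite !inE => xy; elim: s noW {lst lg} => // z s IHs.
  rewrite inE negb_or avoids_cons => /andP[Wz Ws]; rewrite IHs // andbT.
  case/orP: xy => /eqP <-; first by rewrite eq_sym (negPf Wz).
  rewrite negb_and; case: s Ws {IHs} => [|w s]; rewrite ?orbT // inE negb_or.
  by move=> /andP[/negPf Ww _] /=; rewrite [_ == Some W]eq_sym [Some W == _]Ww orbT.
apply: (path_of_code_of (i := 0)); rewrite ?avoidsW //; move: lst.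
by rewrite last_points // /point_at xpair_eqE /=; lia.
Qed.

(** * Statistics read on codes *)

Lemma count_W_path n a es : all (leq^~ n) (a :: es) ->
  count_mem W (path_of n a es) = total_drop a es.
Proof.
elim: es a => [|v es IHes] a.
  by rewrite /= andbT => an; rewrite -(subnKC an) jump_up count_nseq.
move=> /andP[an vesn] /=; rewrite count_cat /= IHes // /jump count_cat !count_nseq.
by rewrite /= mul0n mul1n.
Qed.

Lemma diag_steps_code s : legal 0 s -> diag_steps s = count_mem 0%N (code_of 0 s).
Proof.
pose diag p s := count (fun i => on_diag (nth 0 (p :: walk p s) i)
  && on_diag (nth 0 (p :: walk p s) i.+1)) (iota 0 (size s)).
have diag_cons p x s' : diag p (x :: s') =
    ((on_diag p && on_diag (p + step_vec x)%R) + diag (p + step_vec x)%R s')%N.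
  by rewrite /diag [size _]/= iota0S /= count_map; case: s'.
rewrite -[diag_steps s]/(diag (point_at (0, 0)%N) s).
suff gen c : legal c.2 s -> diag (point_at c) s = count_mem 0%N (code_of c.2 s).
  exact: (gen (0, 0)%N).
elim: s c => [|x s IHs] [i a] // lg.
have [xP lg'] := point_at_move lg.
rewrite diag_cons xP IHs // !on_diag_point_at.
case: x lg {xP lg'} => /= lg; first by rewrite andbb.
  by rewrite andbF.
by case/andP: lg; case: a.
Qed.

(** Height 0 means equal components. The end of the path is left out and its start is
not, so that a step can be peeled off on the left. *)
Fixpoint axis_points (c : nat * nat) (s : seq step) : nat :=
  if s is x :: s' then ((c.2 == c.1) + axis_points (advance c x) s')%N else 0.

Lemma axis_returnsE x s : legal 0 (x :: s) ->
  axis_returns (x :: s) = axis_points (advance (0, 0)%N x) s.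
Proof.
pose tight p s :=
  count (fun i => (nth 0 (p :: walk p s) i).2 == 0) (iota 0 (size s)).
have tight_cons p y s' :
    tight p (y :: s') = ((p.2 == 0)%R + tight (p + step_vec y)%R s')%N.
  by rewrite /tight [size _]/= iota0S /= count_map; case: s'.
have gen c s' : legal c.2 s' -> tight (point_at c) s' = axis_points c s'.
  elim: s' c => [|y s' IHs] [i a] // lg.
  have [xP lg'] := point_at_move lg.
  rewrite tight_cons xP IHs //=; congr (_ + _)%N; lia.
move=> /(@point_at_move (0, 0)%N)[xP lg]; rewrite -gen // -xP.
by rewrite /axis_returns [(size _).-1]/= (iotaDl 1 0) count_map.
Qed.

Lemma axis_points_up i a k s : (a + k <= i)%N ->
  axis_points (i, a) (nseq k D ++ s) = axis_points (i, a + k)%N s.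
Proof.
elim: k a => [|k IHk] a /=; rewrite ?addn0 // => ki.
by rewrite IHk ?addSnnS // ltn_eqF //; lia.
Qed.

Lemma axis_points_down i a k s : (a + k < i)%N ->
  axis_points (i, a + k)%N (nseq k W ++ s) = axis_points (i, a) s.
Proof.
elim: k => [|k IHk] /=; rewrite ?addn0 // => ki.
by rewrite ltn_eqF // addnS /= IHk //; lia.
Qed.

Lemma axis_points_path n i a es :
    (a < i)%N -> is_inversion i es -> (n = i + size es)%N ->
  axis_points (i, a) (path_of n a es) = contacts a i es.
Proof.
elim: es i a => [|v es IHes] i a ai /=.
  rewrite addn0 => _ ->; rewrite -{2}(subnKC (ltnW ai)) jump_up -[nseq _ _]cats0.
  by rewrite axis_points_up // subnKC // ltnW.
case/andP=> vi inves nE; rewrite -(IHes i.+1 v) ?ltnS //; last by rewrite addSnnS.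
case: jumpP ai vi {inves nE IHes} => {}a k ai vi.
  rewrite axis_points_up //=; congr (_ + _)%N.
  by case: eqP => [E|]; rewrite ?andbF // andbT E ai.
rewrite axis_points_down //= ltn_eqF ?(leq_ltn_trans (leq_addr _ _) ai) //.
by rewrite andbF.
Qed.

Lemma valley_heights_path n es : is_inversion 0 es ->
  valley_heights (path_of n 0 es) = map Posz (heights 0 0 es).
Proof.
have lg := legal_path n 0 es.
pose vh p s :=
  [seq (nth 0 (p :: walk p s) i.+1).2 | i <- iota 0 (size s) & factor D U s i].
have vh_cons p x s : vh p (x :: s) =
    (if (x == D) && (ohead s == Some U) then [:: (p + step_vec x).2] else [::])
    ++ vh (p + step_vec x)%R s.
  rewrite /vh [size _]/= iota0S /= filter_map.
  have -> : factor D U (x :: s) 0 = (x == D) && (ohead s == Some U) by case: s.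
  by case: ifP => _ /=; rewrite -map_comp.
have vh_up i a k s : vh (point_at (i, a)) (nseq k D ++ U :: s) =
    (if (0 < k)%N then [:: i%:Z - (a + k)%N%:Z] else [::]) ++
    vh (point_at (i.+1, (a + k)%N)) s.
  elim: k a => [|k IHk] a.
    rewrite addn0 /= vh_cons /=; congr vh; congr pair => /=; lia.
  rewrite /= vh_cons.
  have -> : point_at (i, a) + step_vec D = point_at (i, a.+1) by congr pair => /=; lia.
  rewrite IHk addSnnS; case: k {IHk} => //=.
  by rewrite addn1.
have vh_down i a k s :
    vh (point_at (i, (a + k)%N)) (nseq k W ++ U :: s) = vh (point_at (i.+1, a)) s.
  elim: k => [|k IHk].
    rewrite addn0 /= vh_cons /=; congr vh; congr pair => /=; lia.
  rewrite /= vh_cons -IHk /=; congr vh; congr pair => /=; lia.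
have vh_noU p s : U \notin s -> vh p s = [::].
  elim: s p => [|x s IHs] p //; rewrite inE negb_or vh_cons => /andP[_ Us].
  rewrite IHs // cats0; case: s Us {IHs} => [|y s]; rewrite ?andbF //.
  rewrite inE negb_or => /andP[Uy _] /=.
  by rewrite [_ == Some U]eq_sym [Some U == _](negPf Uy) andbF.
rewrite -[valley_heights _]/(vh (point_at (0, 0)%N) (path_of n 0 es)).
suff gen i a : is_inversion i es -> vh (point_at (i, a)) (path_of n a es) =
    map Posz (heights a i es) by apply: gen.
elim: es i a {lg} => [|v es IHes] i a.
  by move=> _; rewrite vh_noU // mem_cat !mem_nseq !andbF.
rewrite [path_of _ _ _]/= => /andP[vi inves]; case: jumpP vi inves => {}a k ki inves.
  rewrite vh_up IHes //=.
  have -> : (a < a + k)%N = (0 < k)%N by lia.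
  by case: ifP => //= _; congr (_ :: _); lia.
by rewrite vh_down IHes //= ltnNge leq_addr.
Qed.

(** * Marks *)

Fixpoint markings (hs : seq nat) : seq (seq nat) :=
  if hs is h :: hs' then [seq j :: m | j <- iota 0 h.+1, m <- markings hs']
  else [:: [::]].

Lemma markings_cons h hs :
  markings (h :: hs) = [seq j :: m | j <- iota 0 h.+1, m <- markings hs].
Proof. by []. Qed.

Definition mark_hits (m hs : seq nat) : nat :=
  count (fun jk => jk.1 == jk.2) (zip m hs).

Lemma mem_markings m hs :
  (m \in markings hs) = all2 (fun (j : nat) (k : int) => j%:Z <= k) m (map Posz hs).
Proof.
elim: hs m => [|h hs IHhs] m; first by case: m.
rewrite markings_cons.
apply/allpairsPdep/idP => [[j [m' [hj hm ->]]]|].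
  move: hj; rewrite mem_iota ltnS /= lez_nat => ->.
  by rewrite -IHhs.
case: m => [|j m] // /andP[hj hm]; exists j, m.
by rewrite mem_iota IHhs ltnS -lez_nat; split=> //; rewrite hj.
Qed.

Lemma markings_uniq hs : uniq (markings hs).
Proof.
elim: hs => [|h hs IHhs] //; rewrite markings_cons.
by apply: allpairs_uniq_dep => [||[? ?] [? ?] _ _ /= [-> ->]]; rewrite ?iota_uniq.
Qed.

Section MarkSums.
Variables (R : comNzRingType) (q r : R).

Lemma valley_weightE h :
  valley_weight q r h = \sum_(0 <= j < h.+1) q ^+ j * r ^+ (j == h).
Proof.
elim: h => [|h IHh]; first by rewrite big_nat1 mul1r.
rewrite big_nat_recl // !mulr1 /= IHh big_distrr; congr (_ + _).
by apply: eq_bigr => j _; rewrite /= exprS mulrA.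
Qed.

Lemma sum_markings hs :
  \sum_(m <- markings hs) q ^+ sumn m * r ^+ mark_hits m hs =
  \prod_(h <- hs) valley_weight q r h.
Proof.
elim: hs => [|h hs IHhs]; first by rewrite big_seq1 big_nil mulr1.
rewrite markings_cons big_allpairs_dep [RHS]big_cons -IHhs valley_weightE.
rewrite -[iota _ _]/(index_iota 0 h.+1) big_distrl.
apply: eq_bigr => j _; rewrite big_distrr; apply: eq_bigr => m _.
by rewrite /mark_hits /= !exprD; ring.
Qed.
End MarkSums.

(** * Equidistribution *)

Definition steady_codes n := [seq e <- inversion_seqs 0 n | steady_code 0 e].
Definition dyck_codes n := [seq e <- inversion_seqs 0 n | path leq 0 e].
Definition marked_codes n :=
  [seq (c, m) | c <- dyck_codes n, m <- markings (heights 0 0 c)].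

Definition steady_stats (e : seq nat) : nat * nat * nat :=
  (total_drop 0 e, contacts 0 0 e, count_mem 0%N e).
Definition marked_stats (cm : seq nat * seq nat) : nat * nat * nat :=
  (sumn cm.2, mark_hits cm.2 (heights 0 0 cm.1), count_mem 0%N cm.1).

Definition stats_gf (R : comNzRingType) (q r : R) d (s : seq (nat * nat * nat)) : R :=
  \sum_(x <- s) q ^+ x.1.1 * r ^+ x.1.2 * (d <= x.2)%N%:R.

(** Both sides start with the letter 0, which accounts for one of the d zeros. *)
Lemma stats_gf_codes (R : comNzRingType) (q r : R) d n :
  stats_gf q r d (map steady_stats (steady_codes n)) =
  stats_gf q r d (map marked_stats (marked_codes n)).
Proof.
have -> : stats_gf q r d (map steady_stats (steady_codes n)) =
    steady_sum q r n 0 0 0 (atleast R d).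
  rewrite /stats_gf big_map big_filter; apply: eq_bigl => e.
  by rewrite /bounded_code all_predT.
have -> : stats_gf q r d (map marked_stats (marked_codes n)) =
    dyck_sum q r n 0 0 (atleast R d).
  rewrite /stats_gf big_map big_allpairs_dep /= big_filter.
  by apply: eq_bigr => c _; rewrite -sum_markings big_distrl.
case: n => [|n]; first by rewrite steady_sum0 dyck_sum0.
have atleastS : (fun z => atleast R d ((0 == 0) + z)%N) =1 atleast R d.-1.
  by move=> z; rewrite /atleast /=; congr (_%:R); case: d.
rewrite steady_sumS dyck_sumS big_mkcond [RHS]big_mkcond !big_nat1 /= !mul1r.
rewrite (eq_steady_sum _ _ _ _ _ _ atleastS) (eq_dyck_sum _ _ _ _ _ atleastS).
exact: steady_sum_dyck_sum.
Qed.

(** Two indeterminates q and r separate the first two statistics; the third one is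
isolated by subtracting the sums for the thresholds d and d+1. *)
Lemma perm_eq_stats (s1 s2 : seq (nat * nat * nat)) :
    (forall (R : comNzRingType) (q r : R) d, stats_gf q r d s1 = stats_gf q r d s2) ->
  perm_eq s1 s2.
Proof.
move=> gfE; pose q : {poly {poly int}} := ('X)%:P; pose r : {poly {poly int}} := 'X.
pose exact (s : seq (nat * nat * nat)) d :=
  \sum_(x <- s) q ^+ x.1.1 * r ^+ x.1.2 * (x.2 == d)%:R.
have exactE s d : exact s d = stats_gf q r d s - stats_gf q r d.+1 s.
  apply/eqP; rewrite eq_sym subr_eq -big_split; apply/eqP/eq_bigr => x _ /=.
  rewrite -mulrDr; congr (_ * _).
  by rewrite leq_eqVlt eq_sym; case: ltngtP; rewrite ?addr0 ?add0r.
apply/allP => -[[a b] d] _ /=; apply/eqP.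
have countE s : ((exact s d)`_b)`_a = (count_mem (a, b, d) s)%:R.
  rewrite /exact !coef_sum -sum1_count natr_sum [RHS]big_mkcond.
  apply: eq_bigr => -[[a' b'] d'] _ /=.
  rewrite -rmorphXn mulr_natr !coefMn coefCM coefXn mulr_natr !coefMn coefXn.
  rewrite !xpair_eqE eq_sym [b == b']eq_sym.
  by case: (a' == a); case: (b' == b); case: (d' == d).
by have /eqP := countE s1; rewrite exactE !gfE -exactE countE eqr_nat => /eqP ->.
Qed.

(** * From equal distributions to a bijection *)

(** Reordering s2 so that its statistics are listed as those of s1 pairs the elements
of s1 and s2 in the same positions; x0 and y0 are defaults for [nth]. *)
Lemma stat_bijection (T1 T2 S : countType) (x0 : T1) (y0 : T2)
    (P1 : pred T1) (P2 : pred T2) (f1 : T1 -> S) (f2 : T2 -> S)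
    (s1 : seq T1) (s2 : seq T2) :
    uniq s1 -> uniq s2 -> s1 =i P1 -> s2 =i P2 -> perm_eq (map f1 s1) (map f2 s2) ->
  {f : {x | P1 x} -> {y | P2 y} |
    bijective f /\ forall x, f2 (val (f x)) = f1 (val x)}.
Proof.
move=> u1 u2 m1 m2 eq12.
have [p /andP[p_perm /eqP f1E]] : {p | perm_eq p (iota 0 (size s2)) &&
    (map f1 s1 == map (nth (f2 y0) (map f2 s2)) p)}.
  apply: sigW; have [p pP f1E] := perm_iotaP (f2 y0) eq12.
  by exists p; rewrite size_map in pP; rewrite pP f1E eqxx.
pose t2 := map (nth y0 s2) p.
have t2_perm : perm_eq t2 s2.
  by rewrite -[X in perm_eq _ X](mkseq_nth y0); apply: perm_map.
have {}u2 : uniq t2 by rewrite (perm_uniq t2_perm).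
have {}m2 y : (y \in t2) = P2 y by rewrite (perm_mem t2_perm) m2.
have {}f1E : map f1 s1 = map f2 t2.
  rewrite f1E -map_comp; apply/eq_in_map => i.
  by rewrite (perm_mem p_perm) mem_iota => /andP[_ ip]; rewrite (nth_map y0).
have sz : size s1 = size t2 by rewrite -(size_map f1) f1E size_map.
have f_in (x : {x | P1 x}) : P2 (nth y0 t2 (index (val x) s1)).
  by rewrite -m2 mem_nth // -sz index_mem m1; apply: (valP x).
have g_in (y : {y | P2 y}) : P1 (nth x0 s1 (index (val y) t2)).
  by rewrite -[P1 _]m1 mem_nth // sz index_mem m2; apply: (valP y).
exists (fun x => exist P2 _ (f_in x)); split=> [|x] /=.
  exists (fun y => exist P1 _ (g_in y)) => [x|y]; apply: val_inj => /=.
    by rewrite index_uniq ?nth_index // -?sz ?index_mem m1; apply: (valP x).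
  by rewrite index_uniq ?nth_index // ?sz ?index_mem m2; apply: (valP y).
have xs : val x \in s1 by rewrite m1; apply: (valP x).
rewrite -(nth_map y0 (f1 x0)) -?sz ?index_mem // -f1E (nth_map x0) ?index_mem //.
by rewrite nth_index.
Qed.

Lemma inversion_bounded e n : is_inversion 0 e -> size e = n -> all (leq^~ n) (0%N :: e).
Proof.
move=> inve sn /=; apply/allP => v /(mem_inversion_lt inve).
by rewrite add0n sn => /ltnW.
Qed.

Lemma steady_path_stats n e : e \in steady_codes n ->
  (count_mem W (path_of n 0 e), axis_returns (path_of n 0 e), diag_steps (path_of n 0 e)) =
  steady_stats e.
Proof.
rewrite mem_filter mem_inversion_seqs => /and3P[_ /eqP sn inve].
rewrite diag_steps_code ?legal_path // code_of_path.
rewrite count_W_path ?(inversion_bounded inve sn) //; congr (_, _, _).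
have := legal_path n 0 e; case: e sn inve => [|v e] /= sn; first by rewrite -sn.
case/andP; rewrite leqn0 => /eqP -> inve lg.
by rewrite axis_returnsE // axis_points_path.
Qed.

Lemma marked_path_stats n cm : cm \in marked_codes n ->
  (total_mark (path_of n 0 cm.1, cm.2), mark_returns (path_of n 0 cm.1, cm.2),
   diag_steps (path_of n 0 cm.1)) = marked_stats cm.
Proof.
case/allpairsPdep => c [m [+ _ ->]] /=.
rewrite mem_filter mem_inversion_seqs => /and3P[_ _ inve].
rewrite diag_steps_code ?legal_path // code_of_path; congr (_, _, _).
rewrite /mark_returns /= valley_heights_path // /mark_hits.
by elim: (heights _ _ _) (m) => [|h hs IHhs] [|j m'] //=; rewrite IHhs.
Qed.

Definition steady_paths n := map (path_of n 0) (steady_codes n).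
Definition marked_paths n :=
  [seq (path_of n 0 cm.1, cm.2) | cm <- marked_codes n].

Lemma path_of_inj n : injective (path_of n 0).
Proof. exact: can_inj (code_of_path n 0). Qed.

Lemma mem_steady_paths n : steady_paths n =i is_steady n.
Proof.
move=> s; rewrite -[RHS]/(is_steady n s); apply/mapP/idP => [[e + ->]|sP].
  by rewrite mem_filter mem_inversion_seqs is_steady_path => /and3P[-> -> ->].
exists (code_of 0 s); last by rewrite is_steady_code.
rewrite mem_filter mem_inversion_seqs andbC -andbA -(is_steady_path n).
by rewrite is_steady_code.
Qed.

Lemma mem_marked_paths n : marked_paths n =i is_marked_dyck n.
Proof.
move=> [s m]; rewrite -[RHS]/(is_marked_dyck n (s, m)) /is_marked_dyck /=.
apply/mapP/andP => [[cm /allpairsPdep[c [m' [cP mP ->]]] [-> ->]]|[sP mP]].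
  move: cP mP; rewrite mem_filter mem_inversion_seqs is_dyck_path mem_markings.
  by case/and3P => -> -> inve; rewrite valley_heights_path // inve.
have := sP; rewrite -(is_dyck_code sP) is_dyck_path => /and3P[sz inv pth].
exists (code_of 0 s, m); last by rewrite is_dyck_code.
apply/allpairsPdep; exists (code_of 0 s), m; split => //.
  by rewrite mem_filter mem_inversion_seqs pth inv sz.
by rewrite mem_markings -(valley_heights_path n) // is_dyck_code.
Qed.

Lemma steady_paths_uniq n : uniq (steady_paths n).
Proof.
by rewrite map_inj_uniq ?filter_uniq ?inversion_seqs_uniq //; apply: path_of_inj.
Qed.

Lemma marked_paths_uniq n : uniq (marked_paths n).
Proof.
rewrite map_inj_uniq => [|[c m] [c' m'] [/path_of_inj -> -> //]].
apply: allpairs_uniq_dep => [||[? ?] [? ?] _ _ /= [-> ->]] //.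
  by rewrite filter_uniq ?inversion_seqs_uniq.
by move=> c _; apply: markings_uniq.
Qed.

Theorem theorem31 :
  exists f : forall n : nat, steady_path n -> marked_dyck_path n,
    forall n : nat,
      bijective (f n) /\
      forall P : steady_path n,
        [/\ total_mark (val (f n P)) = count_mem W (val P),
            diag_steps (val (f n P)).1 = diag_steps (val P)
          & mark_returns (val (f n P)) = axis_returns (val P)].
Proof.
pose st1 s := (count_mem W s, axis_returns s, diag_steps s).
pose st2 sm := (total_mark sm, mark_returns sm, diag_steps sm.1).
have stats_perm n : perm_eq (map st1 (steady_paths n)) (map st2 (marked_paths n)).
  rewrite -!map_comp.
  have /eq_in_map -> : {in steady_codes n, st1 \o path_of n 0 =1 steady_stats}.
    by move=> e; apply: steady_path_stats.
  have /eq_in_map -> : {in marked_codes n,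
      st2 \o (fun cm => (path_of n 0 cm.1, cm.2)) =1 marked_stats}.
    by move=> cm; apply: marked_path_stats.
  by apply: perm_eq_stats => R q r d; apply: stats_gf_codes.
have f n := stat_bijection [::] ([::], [::]) (steady_paths_uniq n)
  (marked_paths_uniq n) (@mem_steady_paths n) (@mem_marked_paths n) (stats_perm n).
exists (fun n => sval (f n)) => n; case: (f n) => g [gbij gst] /=; split=> // P.
by have [] := gst P.
Qed.
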